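(* Let $d\ge3$ and let $(A,b)$ be a random environment on $(\Omega,\mathcal F,\mathbb P)$ satisfying all the standing assumptions listed in the context. Then there exists $C>0$, independent of $\omega$, such that for each $\omega\in\Omega$ and each $t\ge1$, $$H_{t,\omega}(0)=\int_{\mathbb R^d}-p_{t,\omega}(0,y)\log\left(p_{t,\omega}(0,y)\right)dy\le C\left(\log(t)+1\right).$$
   Context: Environment. $d\ge3$. $(\Omega,\mathcal F,\mathbb P)$ is a probability space with an ergodic group of measure-preserving transformations $\{\tau_x:\Omega\to\Omega\}_{x\in\mathbb R^d}$; $A:\mathbb R^d\times\Omega\to\mathcal S(d)$ (symmetric $d\times d$ matrices) and $b:\mathbb R^d\times\Omega\to\mathbb R^d$ are bi-measurable, $\mathcal F=\sigma(A(x,\cdot),b(x,\cdot)\mid x\in\mathbb R^d)$, and: (stationarity) $A(x+y,\omega)=A(x,\tau_y\omega)$, $b(x+y,\omega)=b(x,\tau_y\omega)$ for all $x,y,\omega$; (boundedness, Lipschitz) there is $C>0$ with $|b(y,\omega)|\le C$, $|A(y,\omega)|\le C$, $|b(x,\omega)-b(y,\omega)|\le C|x-y|$, $|A(x,\omega)-A(y,\omega)|\le C|x-y|$ for all $x,y,\omega$; (ellipticity) there is $\nu>1$ with $\frac1\nu I\le A(y,\omega)\le\nu I$ for all $y,\omega$; (finite range dependence) there is $R>0$ such that, whenever $U,V\subset\mathbb R^d$ have distance $\ge R$, the sigma algebras $\sigma(A(x,\cdot),b(x,\cdot)\mid x\in U)$ and $\sigma(A(x,\cdot),b(x,\cdot)\mid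 x\in V)$ are independent; (restricted isotropy) for every orthogonal transformation $r$ of $\mathbb R^d$ preserving the coordinate axes and every $x\in\mathbb R^d$, $(A(rx,\omega),b(rx,\omega))$ and $(rA(x,\omega)r^t,rb(x,\omega))$ have the same law; (perturbation) there is a small $\eta_0>0$ with $|b(y,\omega)|\le\eta_0$ and $|A(y,\omega)-I|\le\eta_0$ for all $y,\omega$. Here $|M|=\mathrm{tr}(MM^t)^{1/2}$. Green's function. For each $\omega$, $p_{t,\omega}(x,y)$ ($t>0$, $x,y\in\mathbb R^d$) is the Green's function (fundamental solution) of $u_t-\frac12\mathrm{tr}(A(x,\omega)D^2u)+b(x,\omega)\cdot Du=0$ on $\mathbb R^d\times(0,\infty)$: for continuous $f$ growing at most quadratically the solution with $u(\cdot,0)=f$ is $u(x,t)=\int_{\mathbb R^d}p_{t,\omega}(x,y)f(y)\,dy$. The physical entropy is $H_{t,\omega}(x)=\int_{\mathbb R^d}-p_{t,\omega}(x,y)\log(p_{t,\omega}(x,y))\,dy$. *)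

(* Defs.v *)
From HB Require Import structures.
From mathcomp Require Import all_boot all_order all_algebra.
From mathcomp Require Import all_classical all_reals all_analysis.

Set Implicit Arguments.
Unset Strict Implicit.
Unset Printing Implicit Defensive.

Import Order.TTheory GRing.Theory Num.Theory.
Import numFieldNormedType.Exports.

Local Open Scope classical_set_scope.
Local Open Scope ring_scope.

(* Points of R^d are column vectors 'cV[R]_d.  Matrices, hence also points,
   carry the product sigma-algebra generated by their entries; over the reals
   it is the Borel sigma-algebra. *)
Definition measure_matrix_display : measure_display -> measure_display.
Proof. exact. Qed.

Section measurable_matrix.
Context {disp : measure_display} {T : measurableType disp} (m n : nat).

Definition matrix_measurable : set (set 'M[T]_(m, n)) :=
  <<s \bigcup_(ij in [set: 'I_m * 'I_n])
        preimage_set_system setT (fun M : 'M[T]_(m, n) => M ij.1 ij.2)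
          measurable >>.

Let matrix_measurable0 : matrix_measurable set0.
Proof. exact: sigma_algebra0. Qed.

Let matrix_measurableC X : matrix_measurable X -> matrix_measurable (~` X).
Proof. exact: sigma_algebraC. Qed.

Let matrix_measurable_bigcup (F : (set 'M[T]_(m, n))^nat) :
  (forall i, matrix_measurable (F i)) -> matrix_measurable (\bigcup_i F i).
Proof. exact: sigma_algebra_bigcup. Qed.

HB.instance Definition _ := @isMeasurable.Build (measure_matrix_display disp)
  'M[T]_(m, n) matrix_measurable matrix_measurable0 matrix_measurableC
  matrix_measurable_bigcup.

End measurable_matrix.

Lemma measurable_entry disp (T : measurableType disp) m n i j :
  measurable_fun [set: 'M[T]_(m, n)] (fun M => M i j).
Proof.
move=> _ Y mY; apply: sub_sigma_algebra; exists (i, j) => //; exists Y => //.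
Qed.

Lemma measurable_fun_matrix disp disp' (S : measurableType disp)
    (T : measurableType disp') m n (f : S -> 'M[T]_(m, n)) :
  (forall i j, measurable_fun [set: S] (fun x => f x i j)) ->
  measurable_fun [set: S] f.
Proof.
move=> mf; apply: measurability; first reflexivity.
move=> _ [B [[i j] _ [Y mY <-]] <-].
rewrite setTI setTI -[X in measurable X]setTI.
exact: mf.
Qed.


Section lebesgue_vec.
Context {R : realType}.

(* [vcons (a, v)] is the vector whose entry 0 is a, followed by those of v. *)
Definition vcons n (z : measurableTypeR R * 'cV[R]_n) : 'cV[R]_n.+1 :=
  \col_(i < n.+1) oapp (fun j => z.2 j 0) z.1 (unlift ord0 i).

Definition vuncons n (v : 'cV[R]_n.+1) : measurableTypeR R * 'cV[R]_n :=
  (v ord0 0, \col_(j < n) v (lift ord0 j) 0).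

Lemma vconsK n : cancel (@vcons n) (@vuncons n).
Proof.
move=> [a v]; rewrite /vuncons /vcons !mxE unlift_none /=; congr pair.
by apply/colP => j; rewrite !mxE liftK.
Qed.

Lemma measurable_vcons n : measurable_fun [set: _] (@vcons n).
Proof.
apply: measurable_fun_matrix => i j; rewrite (ord1 j).
under eq_fun do rewrite mxE.
case: (unlift ord0 i) => [k|] /=; last exact: measurable_fst.
exact: (measurableT_comp (@measurable_entry _ _ _ _ k 0)).
Qed.

Lemma measurable_vuncons n : measurable_fun [set: _] (@vuncons n).
Proof.
apply: measurable_fun_pair; first exact: measurable_entry.
apply: measurable_fun_matrix => i j.
under eq_fun do rewrite mxE.
exact: measurable_entry.
Qed.

Section step.
Variables (n : nat) (mu : {sigma_finite_measure set 'cV[R]_n -> \bar R}).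
Local Open Scope ereal_scope.

Definition lebesgue_vecS : set 'cV[R]_n.+1 -> \bar R :=
  pushforward (@lebesgue_measure R \x mu) (@vcons n).

Let mvcons A : measurable A -> measurable (@vcons n @^-1` A).
Proof. by move=> mA; rewrite -[X in measurable X]setTI; exact: measurable_vcons. Qed.

Let lebesgue_vecS0 : lebesgue_vecS set0 = 0.
Proof. by rewrite /lebesgue_vecS /pushforward preimage_set0 measure0. Qed.

Let lebesgue_vecS_ge0 A : 0 <= lebesgue_vecS A.
Proof. by rewrite /lebesgue_vecS /pushforward measure_ge0. Qed.

Let lebesgue_vecS_sigma_additive : semi_sigma_additive lebesgue_vecS.
Proof.
move=> F mF tF mUF; rewrite /lebesgue_vecS /pushforward preimage_bigcup.
apply: measure_semi_sigma_additive.
- by move=> k; exact: mvcons.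
- apply/trivIsetP => /= i j _ _ ij; rewrite -preimage_setI.
  by move/trivIsetP : tF => /(_ _ _ _ _ ij) ->//; rewrite preimage_set0.
- by rewrite -preimage_bigcup; exact: mvcons.
Qed.

HB.instance Definition _ := isMeasure.Build _ _ _ lebesgue_vecS
  lebesgue_vecS0 lebesgue_vecS_ge0 lebesgue_vecS_sigma_additive.

Let lebesgue_vecS_sigma_finite : sigma_finite setT lebesgue_vecS.
Proof.
have /sigma_finiteP[F [FT Fnd Foo]] := sigma_finiteT (@lebesgue_measure R).
have /sigma_finiteP[G [GT Gnd Goo]] := sigma_finiteT mu.
exists (fun k => @vuncons n @^-1` (F k `*` G k)).
  rewrite -preimage_bigcup (_ : \bigcup_k _ = setT) ?preimage_setT//.
  apply/seteqP; split => // -[a v] _.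
  have [k _ Fa] : (\bigcup_k F k) a by rewrite -FT.
  have [l _ Gv] : (\bigcup_k G k) v by rewrite -GT.
  exists (maxn k l) => //; split.
    by move: Fa; apply/subsetPset/Fnd; exact: leq_maxl.
  by move: Gv; apply/subsetPset/Gnd; exact: leq_maxr.
move=> k; have [mF Fk] := Foo k; have [mG Gk] := Goo k; split.
  rewrite -[X in measurable X]setTI.
  by apply: measurable_vuncons => //; exact: measurableX.
rewrite /lebesgue_vecS /pushforward -comp_preimage.
rewrite (_ : _ \o _ = id); last by apply/funext => z; exact: vconsK.
by rewrite preimage_id product_measure1E// lte_mul_pinfty// ge0_fin_numE.
Qed.

HB.instance Definition _ := Measure_isSigmaFinite.Build _ _ _ lebesgue_vecS
  lebesgue_vecS_sigma_finite.

End step.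

Fixpoint lebesgue_vec n : {sigma_finite_measure set 'cV[R]_n -> \bar R} :=
  if n is n'.+1 then lebesgue_vecS (lebesgue_vec n') else \d_(0 : 'cV[R]_0).

Lemma lebesgue_vec_box n (X : 'I_n -> set (measurableTypeR R)) :
  (forall i, measurable (X i)) ->
  (lebesgue_vec n [set v : 'cV[R]_n | forall i, X i (v i 0%R)] =
   \prod_(i < n) lebesgue_measure (X i))%E.
Proof.
elim: n X => [|n IHn] X mX.
  by rewrite big_ord0 /= diracE mem_set// => -[].
rewrite big_ord_recl -IHn//= /lebesgue_vecS /pushforward.
rewrite (_ : _ @^-1` _ = X ord0 `*` 
    [set v : 'cV[R]_n | forall i, X (lift ord0 i) (v i 0)]).
  rewrite product_measure1E//.
  rewrite (_ : [set v | _] = \bigcap_(i in [set: 'I_n])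
      ((fun v : 'cV[R]_n => v i 0) @^-1` X (lift ord0 i))); last first.
    by apply/seteqP; split => v /= h i; [move=> _; exact: h|exact: (h i I)].
  apply: fin_bigcap_measurable => // i _.
  rewrite -[X in measurable X]setTI.
  exact: (@measurable_entry _ R n 1 i 0 measurableT _ (mX _)).
apply/seteqP; split => -[a v] /=.
  move=> h; split=> [|i]; first by have := h ord0; rewrite mxE unlift_none.
  by have := h (lift ord0 i); rewrite mxE liftK.
by move=> [h0 h] i; rewrite mxE; case: unliftP => [j|] -> //=.
Qed.

End lebesgue_vec.

Section matrix_notions.
Context {R : realType}.

(* On column vectors this is the Euclidean norm; the library norm on matrices
   is the maximum of the absolute values of the entries. *)
Definition fnorm m n (M : 'M[R]_(m, n)) : R := Num.sqrt (\tr (M *m M^T)).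

Definition loewner_le d (M N : 'M[R]_d) : Prop :=
  forall v : 'cV[R]_d, 0 <= (v^T *m (N - M) *m v) 0 0.

Definition axis_preserving d (r : 'M[R]_d) : Prop :=
  forall i, exists j c, r *m delta_mx i 0 = c *: delta_mx j 0 :> 'cV[R]_d.

End matrix_notions.

Section environment.
Context {R : realType} {d : nat} {disp : measure_display}.
Context {Omega : measurableType disp}.
Variables (P : probability Omega R) (tau : 'cV[R]_d -> Omega -> Omega).
Variables (A : 'cV[R]_d -> Omega -> 'M[R]_d).
Variables (b : 'cV[R]_d -> Omega -> 'cV[R]_d).

Definition coef (x : 'cV[R]_d) (w : Omega) : 'M[R]_d * 'cV[R]_d :=
  (A x w, b x w).

Definition coef_sigma (U : set 'cV[R]_d) : set (set Omega) :=
  <<s \bigcup_(x in U) preimage_set_system setT (coef x) measurable >>.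

Record ergodic_group : Prop := {
  tau_id : tau 0 = id ;
  tau_add : forall x y, tau (x + y) = tau x \o tau y ;
  tau_measurable : forall x, measurable_fun setT (tau x) ;
  tau_preserving : forall x E, measurable E -> P (tau x @^-1` E) = P E ;
  tau_ergodic : forall E, measurable E ->
    (forall x, tau x @^-1` E = E) -> P E = 0%E \/ P E = 1%E }.

(* The size eta0 of the perturbation of the Laplacian is a parameter, so that a
   statement may ask for it to be small or leave it arbitrary. *)
Record random_environment (eta0 : R) : Prop := {
  env_group : ergodic_group ;
  env_sym : forall x w, (A x w)^T = A x w ;
  env_measurable_A :
    measurable_fun setT (fun z : 'cV[R]_d * Omega => A z.1 z.2) ;
  env_measurable_b :
    measurable_fun setT (fun z : 'cV[R]_d * Omega => b z.1 z.2) ;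
  env_generated : @measurable _ Omega = coef_sigma setT ;
  env_stationary : forall x y w,
    A (x + y) w = A x (tau y w) /\ b (x + y) w = b x (tau y w) ;
  env_bounded_lipschitz : exists2 C : R, 0 < C & forall x y w,
    [/\ fnorm (b y w) <= C, fnorm (A y w) <= C,
        fnorm (b x w - b y w) <= C * fnorm (x - y) &
        fnorm (A x w - A y w) <= C * fnorm (x - y)] ;
  env_elliptic : exists2 nu : R, 1 < nu & forall y w,
    loewner_le (nu^-1)%:M (A y w) /\ loewner_le (A y w) nu%:M ;
  env_finite_range : exists2 range : R, 0 < range &
    forall U V : set 'cV[R]_d,
      (forall x y, U x -> V y -> range <= fnorm (x - y)) ->
      forall E F, coef_sigma U E -> coef_sigma V F ->
        P (E `&` F) = (P E * P F)%E ;
  env_isotropic : forall r : 'M[R]_d, r *m r^T = 1%:M -> axis_preserving r ->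
    forall x (B : set ('M[R]_d * 'cV[R]_d)), measurable B ->
      pushforward P (coef (r *m x)) B =
      pushforward P (fun w => (r *m A x w *m r^T, r *m b x w)) B ;
  env_eta0 : 0 < eta0 ;
  env_perturbation : forall y w,
    fnorm (b y w) <= eta0 /\ fnorm (A y w - 1%:M) <= eta0 }.

End environment.

Section green_function.
Context {R : realType} {d : nat}.
Implicit Types (a : 'cV[R]_d -> 'M[R]_d) (b : 'cV[R]_d -> 'cV[R]_d).
Implicit Types (u : 'cV[R]_d -> R -> R) (f g : 'cV[R]_d -> R).

Definition partial (i : 'I_d) f : 'cV[R]_d -> R :=
  fun x => 'D_(delta_mx i 0) f x.

Definition partial_derivable (i : 'I_d) f x : Prop :=
  derivable f x (delta_mx i 0).

Definition gradient f x : 'cV[R]_d := \col_i partial i f x.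

Definition hessian f x : 'M[R]_d := \matrix_(i, j) partial i (partial j f) x.

(* Classical solutions of the Cauchy problem
     u_t - tr(a D^2 u) / 2 + b . Du = 0,   u(., 0) = f,
   continuous up to the initial time and of class C^{2,1} at positive times.
   The last field fixes a class in which the solution is unique: without a
   growth condition uniqueness fails already for the heat equation. *)
Record cauchy_solution a b f u : Prop := {
  sol_continuous :
    {within [set z : 'cV[R]_d * R | 0 <= z.2], continuous (uncurry u)} ;
  sol_initial : forall x, u x 0 = f x ;
  sol_derivable_t : forall x t, 0 < t -> derivable (u x) t 1 ;
  sol_derivable_x : forall i x t, 0 < t -> partial_derivable i (u^~ t) x ;
  sol_derivable_xx : forall i j x t, 0 < t ->
    partial_derivable i (partial j (u^~ t)) x ;
  sol_continuous_t : forall z : 'cV[R]_d * R, 0 < z.2 ->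
    {for z, continuous (fun z : 'cV[R]_d * R => 'D_1 (u z.1) z.2)} ;
  sol_continuous_x : forall i (z : 'cV[R]_d * R), 0 < z.2 ->
    {for z, continuous (fun z : 'cV[R]_d * R => partial i (u^~ z.2) z.1)} ;
  sol_continuous_xx : forall i j (z : 'cV[R]_d * R), 0 < z.2 ->
    {for z, continuous (fun z : 'cV[R]_d * R =>
       partial i (partial j (u^~ z.2)) z.1)} ;
  sol_equation : forall x t, 0 < t ->
    'D_1 (u x) t - 2^-1 * \tr (a x *m hessian (u^~ t) x)
      + ((b x)^T *m gradient (u^~ t) x) 0 0 = 0 ;
  sol_growth : forall T, 0 < T -> exists K : R, forall x t,
    0 < t <= T -> `|u x t| <= K * (1 + fnorm x ^+ 2) }.

(* Uniqueness for the Cauchy problem makes [p t x] unique up to a null set, so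
   positivity and the regularity of the kernel in y need not be assumed. *)
Definition is_green a b (p : R -> 'cV[R]_d -> 'cV[R]_d -> R) : Prop :=
  forall f, continuous f ->
    (exists K : R, forall y, `|f y| <= K * (1 + fnorm y ^+ 2)) ->
    exists2 u, cauchy_solution a b f u &
      forall t x, 0 < t ->
        (lebesgue_vec d).-integrable setT (fun y => (p t x y * f y)%:E) /\
        u x t = \int[lebesgue_vec d]_y (p t x y * f y).

(* Since [ln 0 = 0], the integrand vanishes where the density does. *)
Definition entropy_density (q : 'cV[R]_d -> R) : 'cV[R]_d -> \bar R :=
  fun y => (- (q y * ln (q y)))%:E.

Definition entropy (q : 'cV[R]_d -> R) : \bar R :=
  (\int[lebesgue_vec d]_y entropy_density q y)%E.

(* In [\bar R] one has [+oo - +oo = -oo]; this excludes the case where the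
   integral defining the entropy is of that form. *)
Definition entropy_well_defined (q : 'cV[R]_d -> R) : Prop :=
  (\int[lebesgue_vec d]_y (entropy_density q)^\+ y < +oo)%E.

End green_function.

(* Main.v *)
Require Import Defs.
From mathcomp Require Import all_boot all_order all_algebra.
From mathcomp Require Import all_classical all_reals all_analysis.
From mathcomp Require Import measurable_realfun ring lra.
Import Order.TTheory GRing.Theory Num.Theory.
Import numFieldNormedType.Exports.
Local Open Scope classical_set_scope.
Local Open Scope ring_scope.

(** The entropy of a probability density is at most its cross entropy with any
    other density (Gibbs' inequality).  Comparing [p_t(0, .)] with the centred
    Gaussian of standard deviation [t], whose negative logarithm at [y] is at
    most [|y|^2 / (2 t^2) + d (2 ln t + ln (2 pi))], reduces the entropy bound
    to two facts about [q = p_t(0, .)]: it is nonnegative, and both its mass and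
    its second moment divided by [t^2] are bounded uniformly in [t >= 1] and in
    the environment.

    These facts come from the Cauchy problem alone, so the argument is
    deterministic: it uses ellipticity and boundedness of the coefficients, with
    constants that are the same for every [w].  The kernel is only known through
    the solutions [u(x, t) = int p_t(x, y) f(y) dy], hence through a comparison
    principle ([cauchy_solution_le]): if [f <= b (c + |x|^2)] and
    [La + B2 / k <= k c], where [La] bounds the diffusion and [B2] the squared
    drift, then [u(x, t) <= b e^(k t) (c + |x|^2)].  A bounded drift may push the
    process to distance of order [t], so a rate [k] independent of [t] would give
    an exponential bound; the rate [k = 1 / t], admissible for
    [c = t^2 (La + B2)], gives [int q (c + |y|^2) <= e c], which controls mass and
    second moment at once.

    For nonnegativity the same principle is used with [b = 0]: it shows that
    [int q (c + |y|^2) f >= 0] for all continuous [f] with values between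
    [0] and [1].
    Pointwise limits preserve this inequality, and all indicators of measurable
    sets are obtained from such functions by iterated limits ([baire]), so the
    negative part of [q (c + |y|^2)] integrates to zero
    ([integral_pos_part_le]).

    The comparison principle is proved by the classical argument at a point where
    [u] minus a strict supersolution attains a positive maximum.  The first and
    second order conditions there are read off the restrictions to lines
    ([touching_barrier]), and the second order condition is paired with the
    diffusion matrix by [psd_trace_mul_ge0]. *)

Set Implicit Arguments.
Unset Strict Implicit.
Unset Printing Implicit Defensive.

(** * Derivatives along lines *)

Section one_variable.
Context {R : realType}.
Implicit Types (g : R -> R).

(** Multiplying out the difference quotient makes the estimate meaningful at
    [h = 0] too, and lets errors of several directions be added. *)
Lemma is_derive_dist (V : normedModType R) (f : V -> R) (x v : V) (D : R) :
  is_derive x v f D <->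
  forall e : R, 0 < e -> exists2 r : R, 0 < r &
    forall h : R, `|h| < r -> `|f (x + h *: v) - f x - h * D| <= e * `|h|.
Proof.
split.
- case=> df <- e e0.
  have := df; rewrite /derivable => /cvgrPdist_le /(_ _ e0).
  rewrite /prop_near1 /nbhs /= /within /= => /nbhs_ballP [r /= r0 rP].
  exists r => // h hr; have [->|h0] := eqVneq h 0.
    by rewrite scale0r addr0 subrr mul0r subrr normr0 mulr0.
  have /(_ _ h0) := rP h; rewrite /ball /= sub0r normrN => /(_ hr).
  rewrite -/(derive f x v) => H.
  rewrite -(ler_pM2r (_ : 0 < `|h|)) ?normr_gt0// in H.
  apply: le_trans H; rewrite -normrM distrC mulrBl.
  by rewrite -[_^-1 *: _]/(_^-1 * _) mulrAC mulVf// mul1r [h *: v + x]addrC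
    ['D_v f x * h]mulrC.
- move=> H; suff cv : (fun h => h^-1 *: ((f \o shift x) (h *: v) - f x)) @ 0^' --> D.
    by apply: DeriveDef; [apply/cvg_ex; exists D|exact: cvg_lim].
  apply/cvgrPdist_le => e e0; have [r r0 rP] := H _ e0.
  rewrite /prop_near1 /nbhs /= /within /=; apply/nbhs_ballP; exists r => //= h.
  rewrite /ball /= sub0r normrN => /rP hP h0.
  rewrite -(ler_pM2r (_ : 0 < `|h|)) ?normr_gt0//.
  rewrite -normrM mulrBl -[_^-1 *: _]/(_^-1 * _) mulrAC mulVf// mul1r
    [D * h]mulrC distrC.
  by rewrite [h *: v + x]addrC.
Qed.

(** A maximum over a time interval may sit at its right end point, where only the
    one-sided condition survives. *)
Lemma derive_at_left_max g (t r D : R) : is_derive t 1 g D -> 0 < r ->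
  (forall s, t - r < s < t -> g s <= g t) -> 0 <= D.
Proof.
move=> /is_derive_dist gP r0 gmax; rewrite leNgt; apply/negP => D0.
have [|r' r'0 gr'] := gP (- D / 2); first lra.
pose m := Num.min r r' / 2.
have mr : Num.min r r' <= r by rewrite ge_min lexx.
have mr' : Num.min r r' <= r' by rewrite ge_min lexx orbT.
have m0 : 0 < Num.min r r' by rewrite lt_min r0.
have mm : m = Num.min r r' / 2 by [].
have := gr' (- m); rewrite normrN gtr0_norm; last lra.
rewrite -[_ *: 1]/(_ * 1) mulr1 => /(_ ltac:(lra)).
have := gmax (t - m) => /(_ ltac:(lra)).
move=> g1 /ler_normlP [] ? ?.
nra.
Qed.

(** If [D] were positive, [dg] would be positive just to the right of its zero,
    and [g] would increase there by the mean value theorem. *)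
Lemma second_derivative_test g dg (D : R) : (forall s : R, is_derive s 1 g (dg s)) ->
  is_derive (0 : R) 1 dg D -> (forall s, g s <= g 0) -> dg 0 = 0 /\ D <= 0.
Proof.
move=> dgP DP gmax.
have dg0 : dg 0 = 0.
  have dz : is_derive (0 : R) 1 g 0.
    apply: (@derive1_at_max R g (-1) 1 0); first lra.
    - by move=> t _; have [] := dgP t.
    - by rewrite in_itv/=; lra.
    - by [].
  by have [_ <-] := dgP 0; have [_ ->] := dz.
split=> //; rewrite leNgt; apply/negP => D0.
move/is_derive_dist : DP => /(_ (D / 2)) [|r r0 rP]; first lra.
have r20 : 0 < r / 2 by lra.
have cg : {within `[0, r / 2], continuous g}.
  apply: continuous_subspaceT => x.
  by apply: differentiable_continuous; apply/derivable1_diffP; have [] := dgP x.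
have [c] := @MVT R g dg 0 (r / 2) r20 (fun x _ => dgP x) cg.
rewrite in_itv/= => /andP[c0 cr] gc.
have := rP c; rewrite gtr0_norm// dg0 add0r -[_ *: 1]/(_ * 1) mulr1 subr0.
move=> /(_ ltac:(lra)) /ler_normlP [] H _.
have := gmax (r / 2); rewrite -subr_ge0 => ?.
have : 0 < dg c by nra.
nra.
Qed.

Lemma is_derive_expRM (m t : R) :
  is_derive t 1 (fun t : R => expR (m * t)) (m * expR (m * t)).
Proof.
have dm := is_deriveZ m (is_derive_id t 1).
have [dm1 dm2] := dm; have [de1 de2] := is_derive_expR (m * t).
have -> : (fun t => expR (m * t)) = expR \o (m \*: id) by [].
apply: DeriveDef.
  apply/derivable1_diffP; apply: differentiable_comp; apply/derivable1_diffP => //.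
rewrite -derive1E derive1_comp// !derive1E dm2 /= de2.
by rewrite -[_ *: _]/(_ * _) mulr1 mulrC.
Qed.

End one_variable.

Section directional.
Context {R : realType} {d : nat}.
Implicit Types (f : 'cV[R]_d -> R) (x v y : 'cV[R]_d).

Lemma norm_delta_mx (i : 'I_d) : `|delta_mx i 0 : 'cV[R]_d| <= 1.
Proof.
rewrite [leLHS]/Num.norm /= mx_normrE; apply/bigmax_leP; split => // ij _.
by rewrite mxE; case: (_ && _); rewrite ?normr0 ?normr1.
Qed.

Lemma is_derive_line f x v (s D : R) :
  is_derive (x + s *: v) v f D -> is_derive s 1 (fun s => f (x + s *: v)) D.
Proof.
move=> /is_derive_dist fD; apply/is_derive_dist => e /fD[r r0 rP].
exists r => // h /rP; rewrite -[_ *: 1]/(_ * 1) mulr1.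
by rewrite scalerDl addrA.
Qed.

(** Continuity of the partial derivative at [x] makes the linear approximation
    uniform in the base point [y] near [x]: this is what allows the coordinates
    to be moved one after the other. *)
Lemma partial_strict f i x : (forall y, partial_derivable i f y) ->
  {for x, continuous (partial i f)} ->
  forall e : R, 0 < e -> exists2 r : R, 0 < r &
    forall y (h : R), `|y - x| < r -> `|h| < r ->
    `|f (y + h *: delta_mx i 0) - f y - h * partial i f x| <= e * `|h|.
Proof.
move=> df cf e e0.
have dline y (s : R) : is_derive s 1 (fun s => f (y + s *: delta_mx i 0))
    (partial i f (y + s *: delta_mx i 0)).
  by apply: is_derive_line; apply: DeriveDef => //; exact: df.
have cline y : continuous (fun s : R => f (y + s *: delta_mx i 0)).
  move=> s; apply: differentiable_continuous; apply/derivable1_diffP.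
  by have [] := dline y s.
have /cvgrPdist_le /(_ _ e0) /nbhs_ballP[r /= r0 rP] := cf.
exists (r / 2); first lra.
move=> y h yr hr.
suff [c ch ->] : exists2 c, `|c| <= `|h| &
    f (y + h *: delta_mx i 0) - f y = h * partial i f (y + c *: delta_mx i 0).
  rewrite -mulrBr normrM mulrC ler_wpM2r//.
  rewrite distrC; apply: rP; rewrite -ball_normE /= distrC.
  rewrite addrAC; apply: le_lt_trans (ler_normD _ _) _.
  rewrite normrZ; have := norm_delta_mx i; have := normr_ge0 c.
  by have := normr_ge0 (delta_mx i 0 : 'cV[R]_d); nra.
have [h0|h0] := leP 0 h.
  have [c] := @MVT_segment R _ _ 0 h h0 (fun s _ => dline y s)
    (continuous_subspaceT (cline y)).
  rewrite in_itv/= scale0r addr0 subr0 => /andP[c0 ch] ->; exists c.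
    by rewrite !ger0_norm.
  by rewrite mulrC.
have [c] := @MVT_segment R _ _ h 0 (ltW h0) (fun s _ => dline y s)
  (continuous_subspaceT (cline y)).
rewrite in_itv/= scale0r addr0 sub0r => /andP[c0 ch] E; exists c.
  by rewrite ler0_norm// ltr0_norm//; lra.
by rewrite -opprB E mulrN opprK mulrC.
Qed.

(** The increment is split into moves along one coordinate at a time; the move
    along the [i]-th axis starts from the displaced point [x + h w]. *)
Lemma is_derive_basis_sum f x (c : 'I_d -> R) (l : seq 'I_d) :
  (forall i y, partial_derivable i f y) ->
  (forall i, {for x, continuous (partial i f)}) ->
  is_derive x (\sum_(i <- l) c i *: delta_mx i 0 : 'cV[R]_d) f
    (\sum_(i <- l) c i * partial i f x).
Proof.
move=> df cf; apply/is_derive_dist.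
elim: l => [|i l IH] e e0.
  exists 1 => // h _; rewrite !big_nil scaler0 addr0 mulr0 !subrr normr0.
  by rewrite mulr_ge0// ltW.
set w := \sum_(i <- l) _ in IH *; set W := \sum_(i <- l) _ in IH *.
have e20 : 0 < e / 2 by lra.
have [r1 r10 r1P] := IH _ e20.
have c0 : 0 < `|c i| + 1 by rewrite ltr_wpDl.
have e'0 : 0 < e / 2 / (`|c i| + 1) by rewrite divr_gt0.
have [r2 r20 r2P] := partial_strict (df i) (cf i) e'0.
(* the last two terms keep [h w] and [h c i] within the range of [r2P] *)
pose r := Num.min r1 (Num.min (r2 / (`|c i| + 1)) (r2 / (`|w| + 1))).
have w0 : 0 < `|w| + 1 by rewrite ltr_wpDl.
exists r; first by rewrite !lt_min r10 !divr_gt0.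
move=> h; rewrite !lt_min => /and3P[h1 h2 h3].
rewrite !big_cons -/w -/W [_ *: _ + w]addrC scalerDr addrA scalerA.
have := r1P _ h1.
have := r2P (x + h *: w) (h * c i).
rewrite [x + _]addrC addrK normrZ normrM [_ + x]addrC.
rewrite ltr_pdivlMr// in h2; rewrite ltr_pdivlMr// in h3.
have := normr_ge0 h; have := normr_ge0 (c i); have := normr_ge0 w => ? ? ?.
move=> /(_ ltac:(nra) ltac:(nra)).
move=> H1 H2.
have H3 : e / 2 / (`|c i| + 1) * (`|h| * `|c i|) <= e / 2 * `|h|.
  rewrite mulrAC ler_pdivrMr// -!mulrA ler_wpM2l ?(ltW e0)//.
  rewrite ler_wpM2l// ler_wpM2l//; lra.
apply: le_trans (_ : `|f (x + h *: w) - f x - h * W| +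
  `|f (x + h *: w + (h * c i) *: delta_mx i 0) - f (x + h *: w) -
     h * c i * partial i f x| <= _); last by lra.
apply: le_trans (ler_normD _ _); rewrite le_eqVlt; apply/orP; left; apply/eqP.
by congr Num.norm; ring.
Qed.

Lemma is_derive_partial f x v : (forall i y, partial_derivable i f y) ->
  (forall i, {for x, continuous (partial i f)}) ->
  is_derive x v f (\sum_i v i 0 * partial i f x).
Proof.
move=> df cf; rewrite [X in is_derive _ X](_ : v = \sum_i v i 0 *: delta_mx i 0).
  exact: is_derive_basis_sum.
apply/colP => j; rewrite summxE (bigD1 j)//= big1 ?addr0.
  by rewrite !mxE !eqxx mulr1.
by move=> k kj; rewrite !mxE eq_sym (negbTE kj) mulr0.
Qed.

End directional.

(** * Pairing of positive semidefinite matrices *)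

Section positive_semidefinite.
Context {R : realType} {n : nat}.
Implicit Types (a M : 'M[R]_n) (v w : 'cV[R]_n).

Definition bform a v w : R := (v^T *m a *m w) 0 0.

Lemma bform_sym a v w : a^T = a -> bform a v w = bform a w v.
Proof.
move=> sa; rewrite /bform -[in LHS](trmxK (_ *m _)) mxE.
by rewrite !trmx_mul trmxK sa mulmxA.
Qed.

Lemma bform_delta a i j : bform a (delta_mx i 0) (delta_mx j 0) = a i j.
Proof. by rewrite /bform trmx_delta -rowE -colE !mxE. Qed.

Lemma bform_addZ a v w (s : R) : a^T = a ->
  bform a (v + s *: w) (v + s *: w) =
  bform a v v + 2 * s * bform a v w + s ^+ 2 * bform a w w.
Proof.
move=> sa; have := bform_sym v w sa; rewrite /bform.
have -> : (v + s *: w)^T = v^T + s *: w^T by rewrite linearD linearZ.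
rewrite !mulmxDl !mulmxDr -!scalemxAl -!scalemxAr => E.
by rewrite !mxE in E *; rewrite E; ring.
Qed.

(** Otherwise the form is negative at [e_j + s e_i] for a suitable [s], since it
    is affine in [s]. *)
Lemma psd_diag0 a i j : a^T = a -> (forall v, 0 <= bform a v v) ->
  a i i = 0 -> a j i = 0.
Proof.
move=> sa pa ai0; apply/eqP; apply/negPn/negP => aji0.
have := pa (delta_mx j 0 + (- (a j j + 1) / (2 * a j i)) *: delta_mx i 0).
rewrite bform_addZ// !bform_delta ai0 mulr0 addr0.
rewrite (_ : 2 * _ * _ = - (a j j + 1)); last by field.
lra.
Qed.

(** One step of symmetric Gaussian elimination: when [a] is symmetric and [a k k]
    is nonzero, the subtracted rank one matrix has the same [k]-th column as
    [a]. *)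
Definition eliminate a (k : 'I_n) : 'M[R]_n :=
  a - (a k k)^-1 *: (col k a *m (col k a)^T).

Lemma bform_col a v k : (v^T *m col k a) 0 0 = bform a v (delta_mx k 0).
Proof. by rewrite /bform colE mulmxA. Qed.

Lemma eliminate_sym a k : a^T = a -> (eliminate a k)^T = eliminate a k.
Proof. by move=> sa; rewrite /eliminate linearB linearZ /= trmx_mul trmxK sa. Qed.

Lemma eliminateE a k i j : a^T = a ->
  eliminate a k i j = a i j - (a k k)^-1 * (a i k * a j k).
Proof. by move=> sa; rewrite !mxE big_ord1 !mxE. Qed.

Lemma mulmx_col_row (u v w : 'cV[R]_n) :
  (u^T *m (v *m v^T) *m w) 0 0 = (u^T *m v) 0 0 * (w^T *m v) 0 0.
Proof.
rewrite mulmxA -mulmxA [LHS]mxE big_ord1; congr (_ * _).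
by rewrite -[in RHS](trmxK (w^T *m v)) [in RHS]mxE trmx_mul trmxK.
Qed.

(** The form of [eliminate a k] at [v] is the minimum of the form of [a] over the
    line through [v] in direction [e_k]. *)
Lemma eliminate_psd a k : a^T = a -> (forall v, 0 <= bform a v v) ->
  a k k != 0 -> forall v, 0 <= bform (eliminate a k) v v.
Proof.
move=> sa pa ak0 v.
suff -> : bform (eliminate a k) v v =
    bform a v v - (a k k)^-1 * bform a v (delta_mx k 0) ^+ 2.
  have := pa (v + (- (bform a v (delta_mx k 0) / a k k)) *: delta_mx k 0).
  by rewrite bform_addZ// bform_delta; congr (0 <= _); field.
rewrite /eliminate {1}/bform mulmxBr mulmxBl -scalemxAr -scalemxAl.
rewrite [LHS]mxE [X in _ + X]mxE [X in _ - X]mxE mulmx_col_row.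
by rewrite bform_col.
Qed.

(** Elimination writes [a] as a sum of matrices [l v v^T] with [l > 0], and the
    trace of [v v^T M] is the form of [M] at [v].  The induction is on the number
    of nonzero diagonal entries, which each step decreases. *)
Lemma psd_trace_mul_ge0 a M : a^T = a -> (forall v, 0 <= bform a v v) ->
  (forall v, 0 <= bform M v v) -> 0 <= \tr (a *m M).
Proof.
move=> + + pM; have [m] := ubnP #|[pred i | a i i != 0]|.
elim: m a => // m IH a; rewrite ltnS => am sa pa.
have [k /= ak0|a0] := pickP [pred i | a i i != 0]; last first.
  suff -> : a = 0 by rewrite mul0mx mxtrace0.
  apply/matrixP => i j; rewrite mxE; apply: psd_diag0 => //.
  by have /negbFE/eqP := a0 j.
have akk : 0 < a k k.
  by rewrite lt_neqAle eq_sym ak0 -bform_delta pa.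
have -> : \tr (a *m M) =
    \tr (eliminate a k *m M) + (a k k)^-1 * bform M (col k a) (col k a).
  rewrite {1}(_ : a = eliminate a k + (a k k)^-1 *: (col k a *m (col k a)^T)).
    rewrite mulmxDl raddfD /= -scalemxAl linearZ /=; congr (_ + _ * _).
    rewrite -mulmxA mxtrace_mulC.
    by rewrite /mxtrace big_ord1.
  by rewrite subrK.
apply: addr_ge0; last by rewrite mulr_ge0 ?invr_ge0 ?(ltW akk).
apply: IH; [|exact: eliminate_sym|exact: eliminate_psd].
apply: leq_trans am; apply: proper_card; apply/properP; split.
  apply/fintype.subsetP => i; rewrite !inE; apply: contra => /eqP ai0.
  have aki0 := psd_diag0 k sa pa ai0.
  have aik0 : a i k = 0 by rewrite -sa mxE.
  by rewrite eliminateE// ai0 aik0 mul0r mulr0 subr0.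
by exists k; rewrite ?inE ?negbK// eliminateE// mulKf// subrr.
Qed.

End positive_semidefinite.

(** * Touching a radial barrier from below *)

Section second_order.
Context {R : realType} {d : nat}.
Implicit Types (f : 'cV[R]_d -> R) (x v w : 'cV[R]_d).

Definition dot v w : R := \sum_i v i 0 * w i 0.

Lemma dotC v w : dot v w = dot w v.
Proof. by apply: eq_bigr => i _; rewrite mulrC. Qed.

Lemma dotDr v w x : dot v (w + x) = dot v w + dot v x.
Proof.
by rewrite /dot -big_split; apply: eq_bigr => i _; rewrite mxE mulrDr.
Qed.

Lemma dotZr v w (s : R) : dot v (s *: w) = s * dot v w.
Proof.
by rewrite /dot mulr_sumr; apply: eq_bigr => i _; rewrite mxE mulrCA.
Qed.

Lemma dot_ge0 v : 0 <= dot v v.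
Proof. by apply: sumr_ge0 => i _; rewrite -expr2 sqr_ge0. Qed.

Lemma dot_addZ x v (s : R) :
  dot (x + s *: v) (x + s *: v) = dot x x + s * (2 * dot x v) + s ^+ 2 * dot v v.
Proof.
rewrite dotDr dotZr [dot _ x]dotC [dot _ v]dotC !dotDr !dotZr (dotC v x).
ring.
Qed.

Lemma fnorm_dot v : fnorm v = Num.sqrt (dot v v).
Proof.
congr Num.sqrt; rewrite /dot /mxtrace; apply: eq_bigr => i _.
by rewrite !mxE big_ord1 !mxE.
Qed.

Lemma sqr_fnorm v : fnorm v ^+ 2 = dot v v.
Proof. by rewrite fnorm_dot sqr_sqrtr// dot_ge0. Qed.

Lemma is_derive_line_partial f x v (s : R) :
  (forall i y, partial_derivable i f y) ->
  (forall i, continuous (partial i f)) ->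
  is_derive s 1 (fun s => f (x + s *: v))
    (\sum_i v i 0 * partial i f (x + s *: v)).
Proof.
by move=> df cf; apply: is_derive_line; apply: is_derive_partial => // i; exact: cf.
Qed.

Lemma is_derive_line_hessian f x v :
  (forall i j y, partial_derivable i (partial j f) y) ->
  (forall i j, continuous (partial i (partial j f))) ->
  is_derive (0 : R) 1 (fun s : R => \sum_i v i 0 * partial i f (x + s *: v))
    (bform (hessian f x) v v).
Proof.
move=> df cf.
have -> : (fun s : R => \sum_i v i 0 * partial i f (x + s *: v)) =
    \sum_i (v i 0 *: (fun s : R => partial i f (x + s *: v))).
  by apply/funext => s; rewrite fct_sumE; apply: eq_bigr.
have -> : bform (hessian f x) v v =
    \sum_i (v i 0 *: \sum_j v j 0 * partial j (partial i f) (x + (0 : R) *: v)).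
  rewrite /bform !mxE; apply: eq_bigr => i _; rewrite scale0r addr0.
  rewrite mxE mulrC; congr (_ * _); apply: eq_bigr => j _.
  by rewrite !mxE.
apply: is_derive_sum => i; apply: is_deriveZ.
exact: is_derive_line_partial.
Qed.

(** With [A = |x|^2], [B = x . v] and [D = |v|^2] the differentiated function is the
    barrier [b (c + |.|^2) + e (1 + |.|^2)^2] on the line [x + s v]. *)
Lemma is_derive_quartic (b c e A B D s : R) :
  is_derive s 1 (fun s => b * (c + (A + s * (2 * B) + s ^+ 2 * D)) +
      e * (1 + (A + s * (2 * B) + s ^+ 2 * D)) ^+ 2)
    (b * (2 * B + 2 * s * D) +
     e * (2 * (1 + (A + s * (2 * B) + s ^+ 2 * D)) * (2 * B + 2 * s * D))).
Proof.
pose q : {poly R} := A%:P + (2 * B) *: 'X + D *: 'X^2.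
pose p : {poly R} := b *: (c%:P + q) + e *: (1 + q) ^+ 2.
rewrite [X in is_derive _ _ X](_ : _ = horner p).
  apply: is_derive_eq; rewrite /p /q !poly.derivE !hornerE /=.
  ring.
by apply/funext => r; rewrite /p /q !hornerE /=; ring.
Qed.

Lemma is_derive2_quartic (b c e A B D : R) :
  is_derive (0 : R) 1 (fun s => b * (2 * B + 2 * s * D) +
     e * (2 * (1 + (A + s * (2 * B) + s ^+ 2 * D)) * (2 * B + 2 * s * D)))
   (2 * b * D + e * (4 * (1 + A) * D + 8 * B ^+ 2)).
Proof.
pose q : {poly R} := A%:P + (2 * B) *: 'X + D *: 'X^2.
pose q' : {poly R} := (2 * B)%:P + (2 * D) *: 'X.
pose p : {poly R} := b *: q' + e *: (2 *: (1 + q) * q').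
rewrite [X in is_derive _ _ X](_ : _ = horner p).
  apply: is_derive_eq; rewrite /p /q' /q !poly.derivE !hornerE /=.
  ring.
by apply/funext => r; rewrite /p /q' /q !hornerE /=; ring.
Qed.

(** Only the restrictions to lines through [x] are differentiated, so the barrier
    never has to be differentiated as a function of several variables. *)
Lemma touching_barrier f x (b c e : R) :
  (forall i y, partial_derivable i f y) ->
  (forall i, continuous (partial i f)) ->
  (forall i j y, partial_derivable i (partial j f) y) ->
  (forall i j, continuous (partial i (partial j f))) ->
  (forall y, f y - (b * (c + dot y y) + e * (1 + dot y y) ^+ 2) <=
             f x - (b * (c + dot x x) + e * (1 + dot x x) ^+ 2)) ->
  forall v, dot v (gradient f x) = (2 * b + 4 * e * (1 + dot x x)) * dot x v /\
    bform (hessian f x) v v <=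
      2 * b * dot v v + e * (4 * (1 + dot x x) * dot v v + 8 * dot x v ^+ 2).
Proof.
move=> df cf ddf ccf fmax v.
pose h s := b * (c + (dot x x + s * (2 * dot x v) + s ^+ 2 * dot v v)) +
      e * (1 + (dot x x + s * (2 * dot x v) + s ^+ 2 * dot v v)) ^+ 2.
pose g s := f (x + s *: v) - h s.
have gmax s : g s <= g 0.
  rewrite /g /h -!dot_addZ scale0r addr0; exact: fmax.
have dg s := is_deriveB (is_derive_line_partial x v s df cf)
  (is_derive_quartic b c e (dot x x) (dot x v) (dot v v) s).
have ddg := is_deriveB (is_derive_line_hessian x v ddf ccf)
  (is_derive2_quartic b c e (dot x x) (dot x v) (dot v v)).
have [] := @second_derivative_test R g _ _ dg ddg gmax.
rewrite subr_le0 => /eqP; rewrite subr_eq0 => /eqP E H; split=> //.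
rewrite scale0r addr0 in E.
transitivity (\sum_i v i 0 * partial i f x).
  by apply: eq_bigr => i _; rewrite mxE.
by rewrite E; ring.
Qed.

End second_order.

(** * The comparison principle *)

Section compactness.
Context {R : realType} {d : nat}.

Lemma compact_box (r : R) : compact [set x : 'cV[R]_d | forall i, `|x i 0| <= r].
Proof.
have ctr : continuous (fun x : 'rV[R]_d => x^T).
  move=> x A /nbhs_ballP[e e0 eA]; apply/nbhs_ballP; exists e => //= y [_ xy].
  by apply: eA; split => // i j; rewrite !mxE; exact: xy.
have cb : compact [set v : 'rV[R]_d | forall i, `[- r, r]%classic (v ord0 i)].
  by apply: (@rV_compact R d (fun=> `[- r, r]%classic)) => i; exact: segment_compact.
have := continuous_compact (continuous_subspaceT ctr) cb.
congr compact; apply/seteqP; split => [_ [v vP <-] i|x xP].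
  by rewrite mxE ler_norml; have := vP i; rewrite /= in_itv.
exists x^T; last by rewrite trmxK.
by move=> i; rewrite /= in_itv /= mxE -ler_norml.
Qed.

Lemma continuous_dot : continuous (fun x : 'cV[R]_d => dot x x).
Proof.
apply: continuous_big => [|i _ x]; first exact: add_continuous.
have ci : continuous (fun y : 'cV[R]_d => y i 0) by exact: coord_continuous.
apply: (cvgM (ci x) (ci x)).
Qed.

Lemma continuous_slice (F : 'cV[R]_d -> R -> R) (t : R) :
  (forall z : 'cV[R]_d * R, 0 < z.2 ->
    {for z, continuous (fun z : 'cV[R]_d * R => F z.1 z.2)}) ->
  0 < t -> continuous (F^~ t).
Proof.
move=> cF t0 x.
have cp : (fun y : 'cV[R]_d => (y, t)) @ nbhs x --> (x, t).
  exact: (cvg_pair cvg_id (cvg_cst t)).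
exact: (cvg_comp _ _ cp (cF (x, t) t0)).
Qed.

End compactness.

Section comparison.
Context {R : realType} {d : nat}.
Variables (a : 'cV[R]_d -> 'M[R]_d) (bb : 'cV[R]_d -> 'cV[R]_d).
Variables (La B2 : R).
Hypothesis a_sym : forall x, (a x)^T = a x.
Hypothesis a_psd : forall x v, 0 <= bform (a x) v v.
Hypothesis a_trace : forall x, \tr (a x) <= La.
Hypothesis a_bound : forall x v, bform (a x) v v <= La * dot v v.
Hypothesis b_bound : forall x, dot (bb x) (bb x) <= B2.

(** Expand [0 <= |y + k x|^2].  The weight [k] decides how much of the drift term
    is charged to the growth of [|x|^2]. *)
Lemma two_dot_le (x y : 'cV[R]_d) (k : R) : 0 < k ->
  - (2 * dot x y) <= dot y y / k + k * dot x x.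
Proof.
move=> k0; have := dot_ge0 (y + k *: x); rewrite dot_addZ (dotC y x) => H.
suff -> : dot y y / k + k * dot x x =
    k^-1 * (dot y y + k * (2 * dot x y) + k ^+ 2 * dot x x) - 2 * dot x y.
  have : 0 <= k^-1 * (dot y y + k * (2 * dot x y) + k ^+ 2 * dot x x).
    by rewrite mulr_ge0// invr_ge0 ltW.
  lra.
by field; rewrite gt_eqF.
Qed.

(** The matrix [p I + q x x^T - H] is positive semidefinite; pair it with
    [a x]. *)
Lemma trace_hessian_le (x : 'cV[R]_d) (H : 'M[R]_d) (p q : R) :
  0 <= p -> 0 <= q ->
  (forall v, bform H v v <= p * dot v v + q * dot x v ^+ 2) ->
  \tr (a x *m H) <= p * La + q * (La * dot x x).
Proof.
move=> p0 q0 HH.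
pose M := p%:M + q *: (x *m x^T) - H.
have dotE (v w : 'cV[R]_d) : (v^T *m w) 0 0 = dot v w.
  by rewrite mxE; apply: eq_bigr => i _; rewrite mxE.
have pM v : 0 <= bform M v v.
  rewrite /bform /M mulmxBr mulmxBl mulmxDr mulmxDl -scalemxAr -scalemxAl.
  rewrite mul_mx_scalar -scalemxAl.
  rewrite [X in 0 <= X]mxE [X in _ <= X + _]mxE [X in _ <= X + _ + _]mxE.
  rewrite [X in _ <= _ + X + _]mxE [X in _ <= _ + X]mxE mulmx_col_row !dotE.
  by rewrite -/(bform H v v) subr_ge0 (dotC v x) -expr2; exact: HH.
have := psd_trace_mul_ge0 (a_sym x) (a_psd x) pM.
rewrite /M mulmxBr mulmxDr mul_mx_scalar -scalemxAr.
rewrite raddfB raddfD /= !linearZ /= subr_ge0 => /le_trans; apply.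
apply: lerD; first by rewrite ler_wpM2l.
rewrite ler_wpM2l// mulmxA mxtrace_mulC mulmxA /mxtrace big_ord1.
exact: a_bound.
Qed.

(** The condition [La + B2 / k <= k c] makes [b e^(k t) (c + |x|^2)] a
    supersolution.  Adding [e e^(la t) (1 + |x|^2)^2], with [la] so large that
    this is a strict supersolution, beats the quadratic growth of [u] and turns
    the supremum of the difference into a maximum; then [e] tends to [0]. *)
Lemma cauchy_solution_le f u (b c k : R) : cauchy_solution a bb f u ->
  0 <= b -> 0 <= c -> 0 < k -> La + B2 / k <= k * c ->
  (forall x, f x <= b * (c + dot x x)) ->
  forall x t, 0 < t -> u x t <= b * expR (k * t) * (c + dot x x).
Proof.
move=> usol b0 c0 k0 kc fle x1 T T0.
have La0 : 0 <= La.
  by apply: le_trans (a_trace 0); rewrite sumr_ge0 // => i _; rewrite -bform_delta.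
have B20 : 0 <= B2 by apply: le_trans (b_bound 0); exact: dot_ge0.
pose la := 6 * La + 2 * B2 + 3.
have la0 : 0 <= la by rewrite /la; lra.
(* the error allowed at the point (x1, T) is the value there of the added quartic
   term, for a suitable e *)
apply/ler_addgt0Pr => e' e'0.
have r10 : 0 < expR (la * T) * (1 + dot x1 x1) ^+ 2.
  by rewrite mulr_gt0 ?expR_gt0// exprn_gt0// ltr_pwDl// dot_ge0.
pose e := e' / (expR (la * T) * (1 + dot x1 x1) ^+ 2).
have e0 : 0 < e by rewrite divr_gt0.
have -> : e' = e * expR (la * T) * (1 + dot x1 x1) ^+ 2.
  by rewrite -mulrA mulfVK// gt_eqF.
move: (e) e0 => {e r10 e' e'0} e e0.
pose h (x : 'cV[R]_d) (t : R) := b * expR (k * t) * (c + dot x x) +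
  e * expR (la * t) * (1 + dot x x) ^+ 2.
pose w (z : 'cV[R]_d * R) := u z.1 z.2 - h z.1 z.2.
rewrite leNgt; apply/negP => wT.
have w1 : 0 < w (x1, T) by rewrite /w subr_gt0.
have [K uK] := sol_growth usol T0.
(* outside the ball of squared radius r the barrier exceeds the growth bound; as
   1 <= r, a point outside the box of half-width r is outside this ball *)
pose r := 1 + `|K| / e.
have r1 : 1 <= r by rewrite lerDl divr_ge0// ltW.
pose Q : set ('cV[R]_d * R) :=
  [set x : 'cV[R]_d | forall i, `|x i 0| <= r] `*` `[0, T]%classic.
have w_init (x : 'cV[R]_d) : w (x, 0) < 0.
  rewrite /w /h /= (sol_initial usol) !mulr0 expR0 !mulr1 subr_lt0.
  apply: le_lt_trans (fle x) _; rewrite ltrDl mulr_gt0// exprn_gt0//.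
  by rewrite ltr_pwDl// dot_ge0.
have w_far (x : 'cV[R]_d) (t : R) : 0 <= t <= T -> r < dot x x -> w (x, t) < 0.
  move=> /andP[]; rewrite le_eqVlt => /predU1P[<- _ _|t0 tT rx]; first exact: w_init.
  rewrite /w /h /= subr_lt0.
  have /ler_normlP[_ ut] : `|u x t| <= K * (1 + dot x x).
    by rewrite -sqr_fnorm; apply: uK; rewrite t0.
  have Kr : `|K| < e * (1 + dot x x).
    by rewrite -ltr_pdivrMl// mulrC; move: rx; rewrite /r; lra.
  have dx : 0 < 1 + dot x x by rewrite ltr_pwDl// dot_ge0.
  have h1 : 0 <= b * expR (k * t) * (c + dot x x).
    by rewrite !mulr_ge0 ?expR_ge0// addr_ge0// dot_ge0.
  have h2 : e * (1 + dot x x) ^+ 2 <= e * expR (la * t) * (1 + dot x x) ^+ 2.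
    rewrite ler_wpM2r ?sqr_ge0// ler_peMr ?(ltW e0)//.
    by rewrite -expR0 ler_expR mulr_ge0// ltW.
  have := ler_norm K; nra.
have cu : {within [set z : 'cV[R]_d * R | 0 <= z.2],
    continuous (fun z : 'cV[R]_d * R => u z.1 z.2)}.
  rewrite (_ : (fun _ => _) = uncurry u); first exact: sol_continuous usol.
  by apply/funext => -[].
have ch : continuous (fun z : 'cV[R]_d * R => h z.1 z.2).
  move=> z.
  have cd : (fun z : 'cV[R]_d * R => dot z.1 z.1) @ z --> dot z.1 z.1.
    apply: (@cvg_comp _ _ _ fst (fun x => dot x x) _ (nbhs z.1)).
      exact: cvg_fst.
    exact: continuous_dot.
  have ce (m : R) : (fun z : 'cV[R]_d * R => expR (m * z.2)) @ z --> expR (m * z.2).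
    apply: (cvg_comp (fun z : 'cV[R]_d * R => m * z.2) expR).
      by apply: cvgM; [exact: cvg_cst|exact: cvg_snd].
    exact: continuous_expR.
  apply: cvgD; apply: cvgM.
  + by apply: cvgM; [exact: cvg_cst|exact: ce].
  + by apply: cvgD; [exact: cvg_cst|exact: cd].
  + by apply: cvgM; [exact: cvg_cst|exact: ce].
  + under eq_fun do rewrite expr2; rewrite expr2.
    by apply: cvgM; (apply: cvgD; [exact: cvg_cst|exact: cd]).
have [[x0 t0] /[!inE] -[/= _]] :
    exists2 z, z \in Q & forall z', z' \in Q -> w z' <= w z.
  apply: compact_EVT_max.
  - exists (0, 0); split=> /=; last by rewrite in_itv /= lexx ltW.
    by move=> i; rewrite mxE normr0; lra.
  - by apply: compact_setX; [exact: compact_box|exact: segment_compact].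
  - move=> z; apply: cvgB.
      apply: (continuous_subspaceW (B := [set z : 'cV[R]_d * R | 0 <= z.2])).
        by move=> [y s] [_] /=; rewrite in_itv => /andP[].
      exact: cu.
    exact: (continuous_subspaceT ch).
rewrite in_itv /= => /andP[t00 t0T] wmax.
have wmax' (x : 'cV[R]_d) (t : R) : 0 <= t <= T -> 0 < w (x, t) -> w (x, t) <= w (x0, t0).
  move=> tT wxt; apply: wmax; rewrite inE; split => /=; last by rewrite in_itv.
  move=> i; rewrite leNgt; apply/negP => xi; move: wxt; rewrite ltNge => /negP; apply.
  apply/ltW; apply: w_far => //.
  rewrite /dot (bigD1 i)//=.
  have : 0 <= \sum_(j < d | j != i) x j 0 * x j 0.
    by apply: sumr_ge0 => j _; rewrite -expr2 sqr_ge0.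
  have : x i 0 * x i 0 = `|x i 0| * `|x i 0| by rewrite -!expr2 real_normK ?num_real.
  move=> -> ?; nra.
have w0 : 0 < w (x0, t0).
  by apply: (lt_le_trans w1); apply: wmax' => //; rewrite (ltW T0) /=.
have wglob (x : 'cV[R]_d) (t : R) : 0 <= t <= T -> w (x, t) <= w (x0, t0).
  move=> tT; have [wx|wx] := leP (w (x, t)) 0; last exact: wmax'.
  exact: le_trans wx (ltW w0).
have t0_gt0 : 0 < t0.
  rewrite lt_neqAle t00 andbT; apply/eqP => t0E; move: w0.
  by rewrite -t0E ltNge ltW.
pose b' := b * expR (k * t0); pose e' := e * expR (la * t0).
have b'0 : 0 <= b' by rewrite mulr_ge0 ?expR_ge0.
have e'0 : 0 < e' by rewrite mulr_gt0 ?expR_gt0.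
have umax y : u y t0 - (b' * (c + dot y y) + e' * (1 + dot y y) ^+ 2) <=
    u x0 t0 - (b' * (c + dot x0 x0) + e' * (1 + dot x0 x0) ^+ 2).
  by apply: (wglob y t0); rewrite t00.
have touch := touching_barrier
  (fun i y => @sol_derivable_x _ _ _ _ _ _ usol i y t0 t0_gt0)
  (fun i => @continuous_slice _ _ (fun y t => partial i (u^~ t) y) t0
    (@sol_continuous_x _ _ _ _ _ _ usol i) t0_gt0)
  (fun i j y => @sol_derivable_xx _ _ _ _ _ _ usol i j y t0 t0_gt0)
  (fun i j => @continuous_slice _ _
    (fun y t => partial i (partial j (u^~ t)) y) t0
    (@sol_continuous_xx _ _ _ _ _ _ usol i j) t0_gt0) umax.
have rr0 := dot_ge0 x0; set rr := dot x0 x0 in rr0 touch.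
have ut : k * b' * (c + rr) + la * e' * (1 + rr) ^+ 2 <= 'D_1 (u x0) t0.
  have dut : derivable (u x0) t0 1 by exact: (sol_derivable_t usol).
  have dg := is_deriveB (derivableP dut) (is_deriveD
    (is_deriveZ (b * (c + rr)) (is_derive_expRM k t0))
    (is_deriveZ (e * (1 + rr) ^+ 2) (is_derive_expRM la t0))).
  have : 0 <= _ := derive_at_left_max dg t0_gt0 _; rewrite subrr subr_ge0.
  move=> H; apply: le_trans (H _) => [|s /andP[s0 st]].
    by rewrite /b' /e' -![_ *: _]/(_ * _) le_eqVlt; apply/orP; left; apply/eqP; ring.
  have := wglob x0 s; rewrite (ltW s0) (le_trans (ltW st) t0T) => /(_ isT).
  rewrite /w /h /= -/rr; congr (_ - _ <= _ - _).
    rewrite -[RHS]/(b * (c + rr) * expR (k * s) + e * (1 + rr) ^+ 2 * expR (la * s)).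
    by ring.
  rewrite -[RHS]/(b * (c + rr) * expR (k * t0) + e * (1 + rr) ^+ 2 * expR (la * t0)).
  by ring.
have pde := sol_equation usol x0 t0_gt0.
have [grad _] := touch (bb x0).
have Hle : \tr (a x0 *m hessian (u^~ t0) x0) <=
    (2 * b' + 4 * e' * (1 + rr)) * La + 8 * e' * (La * rr).
  have er0 : 0 <= e' * rr by rewrite mulr_ge0// ltW.
  apply: trace_hessian_le; [lra|lra|].
  move=> v; have [_] := touch v.
  by congr (_ <= _); ring.
have gradE : ((bb x0)^T *m gradient (u^~ t0) x0) 0 0 =
    (2 * b' + 4 * e' * (1 + rr)) * dot x0 (bb x0).
  by rewrite -grad mxE; apply: eq_bigr => i _; rewrite mxE.
rewrite gradE in pde.
have Bk := two_dot_le x0 (bb x0) k0.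
have B1 := two_dot_le x0 (bb x0) ltr01.
have b0_bound := b_bound x0.
have kB : dot (bb x0) (bb x0) / k <= B2 / k by rewrite ler_wpM2r// invr_ge0 ltW.
rewrite divr1 mul1r in B1; rewrite -/rr in Bk B1.
set D := dot x0 (bb x0) in Bk B1 pde.
set tr := \tr _ in Hle pde; set U := 'D_1 (u x0) t0 in ut pde.
set S := dot (bb x0) (bb x0) in B1 b0_bound.
(* the two parts of the barrier contradict the equation separately: the quadratic
   one by the condition on k and c, the quartic one by the choice of la *)
have E1 : b' * (La - 2 * D) <= k * b' * (c + rr).
  by rewrite [leRHS]mulrAC [leRHS]mulrC ler_wpM2l//; nra.
have E2 : e' * (2 * (1 + rr) * La + 4 * La * rr - 4 * (1 + rr) * D) <
    la * e' * (1 + rr) ^+ 2.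
  rewrite [ltRHS]mulrAC [ltRHS]mulrC ltr_pM2l//.
  have : (1 + rr) * (- (2 * D)) <= (1 + rr) * (B2 + rr) by rewrite ler_wpM2l//; lra.
  rewrite /la; nra.
lra.
Qed.

End comparison.

(** * Testing against continuous functions *)

Lemma cvg_maxr {R : realType} {T : Type} (F : set_system T) {FF : Filter F}
    (f g : T -> R) (a b : R) : f x @[x --> F] --> a -> g x @[x --> F] --> b ->
  Num.max (f x) (g x) @[x --> F] --> Num.max a b.
Proof.
move=> fa gb; rewrite maxr_absE; under eq_fun do rewrite maxr_absE.
apply: cvgM; last exact: cvg_cst.
by apply: cvgD; [exact: cvgD|apply: cvg_norm; exact: cvgB].
Qed.

Section baire_functions.
Context {R : realType} {d : nat}.
Implicit Types (f g : 'cV[R]_d -> R) (E : set 'cV[R]_d).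

(** The closure of the continuous functions with values between [0] and [1]
    under pointwise limits of sequences.  Measurability is required of the
    continuous functions because the sigma-algebra on vectors is the one
    generated by the entries, not by the open sets. *)
Inductive baire : ('cV[R]_d -> R) -> Prop :=
| baire_continuous f : continuous f -> measurable_fun setT f ->
    (forall y, 0 <= f y <= 1) -> baire f
| baire_lim (g_ : nat -> 'cV[R]_d -> R) g : (forall n, baire (g_ n)) ->
    (forall y, g_ n y @[n --> \oo] --> g y) -> baire g.

Lemma baire_itv g : baire g -> forall y, 0 <= g y <= 1.
Proof.
elim=> // g_ {}g _ IH cg y.
have cv : cvgn (fun n => g_ n y) by apply/cvg_ex; exists (g y).
rewrite -(cvg_lim _ (cg y))//; apply/andP; split.
  by apply: limr_ge => //; near=> n; have /andP[] := IH n y.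
by apply: limr_le => //; near=> n; have /andP[] := IH n y.
Unshelve. all: by end_near. Qed.

Lemma baire_measurable g : baire g -> measurable_fun setT g.
Proof.
elim=> // g_ {}g _ IH cg.
by apply: (measurable_fun_cvg IH) => y _; exact: cg.
Qed.

Lemma baire_onem g : baire g -> baire (fun y => 1 - g y).
Proof.
elim=> [f cf mf f01|g_ {}g _ IH cg].
  apply: baire_continuous.
  - by move=> y; exact: (cvgB (cvg_cst _) (cf y)).
  - exact: measurable_funB.
  - by move=> y; have := f01 y; lra.
by apply: (baire_lim IH) => y; apply: cvgB; [exact: cvg_cst|exact: cg].
Qed.

(** The inductions on the two arguments are nested: the maximum with a fixed
    function commutes with limits. *)
Lemma baire_max g1 g2 : baire g1 -> baire g2 ->
  baire (fun y => Num.max (g1 y) (g2 y)).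
Proof.
move=> + b2; elim=> [f1 cf1 mf1 f101|g_ g _ IH cg]; last first.
  by apply: (baire_lim IH) => y; exact: (cvg_maxr (cg y) (cvg_cst _)).
elim: b2 => [f2 cf2 mf2 f201|g_ g _ IH cg]; last first.
  by apply: (baire_lim IH) => y; exact: (cvg_maxr (cvg_cst _) (cg y)).
apply: baire_continuous.
- by move=> y; exact: (@cvg_maxr _ _ _ (nbhs_filter (y : 'cV[R]_d)) _ _ _ _ (cf1 y) (cf2 y)).
- exact: measurable_maxr.
- by move=> y; case: (leP (f1 y) (f2 y)).
Qed.

Definition baire_set E := baire (\1_E : 'cV[R]_d -> R).

Lemma baire_set0 : baire_set set0.
Proof.
rewrite /baire_set (_ : \1_set0 = cst 0); last first.
  by apply/funext => y; rewrite indicE in_set0.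
apply: baire_continuous; [exact: cst_continuous|exact: measurable_cst|].
by move=> y; rewrite /= lexx ler01.
Qed.

Lemma baire_setC E : baire_set E -> baire_set (~` E).
Proof.
move=> /baire_onem; congr baire; apply/funext => y.
by rewrite !indicE in_setC; case: (y \in E); rewrite ?subrr ?subr0.
Qed.

Lemma baire_setU E F : baire_set E -> baire_set F -> baire_set (E `|` F).
Proof.
move=> bE bF; have := baire_max bE bF; congr baire; apply/funext => y.
rewrite !indicE in_setU.
by case: (y \in E); case: (y \in F); rewrite /= ?maxxx// ?(max_r ler01)// (max_l ler01).
Qed.

(** The indicators of the finite partial unions are eventually constant at every
    point. *)
Lemma baire_bigcup (F : (set 'cV[R]_d)^nat) :
  (forall k, baire_set (F k)) -> baire_set (\bigcup_k F k).
Proof.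
move=> bF; apply: (@baire_lim (fun n => \1_(\big[setU/set0]_(k < n) F k))).
  move=> n; rewrite -/(baire_set _); elim: n => [|n IH].
    by rewrite big_ord0; exact: baire_set0.
  by rewrite big_ord_recr; exact: baire_setU.
move=> y; rewrite !indicE; have [[k _ Fky]|nF] := pselect ((\bigcup_k F k) y).
  rewrite mem_set; last by exists k.
  apply: cvg_near_cst; exists k.+1 => // n /= kn; rewrite indicE mem_set//.
  by rewrite -bigcup_mkord; exists k.
rewrite memNset//; apply: cvg_near_cst; exists 0%N => // n _ /=.
rewrite indicE memNset// -bigcup_mkord => -[k /= _ Fky].
by apply: nF; exists k.
Qed.

(** The truncated ramps [min 1 (n (y_i - r)^+)] increase to the indicator of an
    open half-space. *)
Lemma baire_ray (i : 'I_d) (r : R) : baire_set [set y : 'cV[R]_d | r < y i 0].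
Proof.
(* min 1 z is written 1 - max 0 (1 - z), so that only maxima occur *)
pose g n (y : 'cV[R]_d) := 1 - Num.max 0 (1 - n%:R * Num.max 0 (y i 0 - r)).
have cc : continuous (fun y : 'cV[R]_d => y i 0) by exact: coord_continuous.
apply: (@baire_lim g).
  move=> n; apply: baire_continuous.
  - move=> y; exact: (cvgB (cvg_cst _) (cvg_maxr (cvg_cst _) (cvgB (cvg_cst _)
      (cvgM (cvg_cst _) (cvg_maxr (cvg_cst _) (cvgB (cc y) (cvg_cst _))))))).
  - apply: measurable_funB => //; apply: measurable_maxr => //.
    apply: measurable_funB => //; apply: measurable_funM => //.
    apply: measurable_maxr => //; apply: measurable_funB => //.
    exact: measurable_entry.
  - move=> y; have z0 : 0 <= n%:R * Num.max 0 (y i 0 - r).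
      by rewrite mulr_ge0// le_max lexx.
    rewrite /g; move: (n%:R * _) z0 => z z0.
    by case: (leP 0 (1 - z)) => ?; apply/andP; split; lra.
move=> y; rewrite indicE; case: (ltP r (y i 0)) => ry.
  rewrite mem_set//; apply: cvg_near_cst.
  have ry0 : 0 < y i 0 - r by rewrite subr_gt0.
  near=> n; rewrite /g (max_r (ltW ry0)) max_l ?subr0// subr_le0.
  rewrite -ler_pdivrMr//; near: n; exact: nbhs_infty_ger.
rewrite memNset; last by rewrite /= ltNge ry.
apply: cvg_near_cst; exists 0%N => // n _; rewrite /g /=.
by rewrite (max_l (_ : y i 0 - r <= 0)) ?subr_le0// mulr0 subr0 max_r ?subrr.
Unshelve. all: by end_near. Qed.

(** Sets with indicator in [baire] form a sigma-algebra containing the half-spaces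
    that generate the measurable sets. *)
Lemma measurable_baire_set E : measurable E -> baire_set E.
Proof.
move: E; apply: smallest_sub.
  split; [exact: baire_set0|move=> E; rewrite setTD; exact: baire_setC|].
  exact: baire_bigcup.
move=> _ [[i j] _ [Y mY <-]]; rewrite /= (ord1 j) setTI.
pose G := [set Z : set R | baire_set [set y : 'cV[R]_d | Z (y i 0)]].
suff : G Y by [].
have {}mY : (@RGenOInfty.G R).-sigma.-measurable Y.
  by rewrite -RGenOInfty.measurableE.
move: Y mY; apply: smallest_sub.
  split; rewrite /G /=.
  - exact: baire_set0.
  - move=> Z /baire_setC; congr baire_set.
    by apply/seteqP; split => y /=; [|case].
  - by move=> F bF; exact: (baire_bigcup bF).
move=> _ [r ->]; rewrite /G /=.
rewrite (_ : [set y | _] = [set y : 'cV[R]_d | r < y i 0]); first exact: baire_ray.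
by apply/seteqP; split => y /=; rewrite in_itv /= andbT.
Qed.

Variable mu : {measure set 'cV[R]_d -> \bar R}.

(** By dominated convergence the inequality for continuous [f] extends to [baire]
    functions, in particular to the indicator of the set where [Q < 0], and
    [Num.max Q 0] is [Q] minus its product with this indicator. *)
Lemma integral_pos_part_le (Q : 'cV[R]_d -> R) :
  mu.-integrable setT (EFin \o Q) ->
  (forall f, continuous f -> measurable_fun setT f -> (forall y, 0 <= f y <= 1) ->
    (0 <= \int[mu]_y (Q y * f y)%:E)%E) ->
  (\int[mu]_y (Num.max (Q y) 0)%:E <= \int[mu]_y (Q y)%:E)%E.
Proof.
move=> iQ tQ.
have mQ : measurable_fun setT Q by apply/measurable_EFinP; exact: measurable_int iQ.
have iQg g : baire g -> mu.-integrable setT (fun y => (Q y * g y)%:E).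
  move=> bg; apply: le_integrable iQ => //.
    apply/measurable_EFinP; apply: measurable_funM => //; exact: baire_measurable.
  move=> y _; rewrite lee_fin normrM ler_piMr//.
  by have /andP[? ?] := baire_itv bg y; rewrite ger0_norm.
have Qg0 g : baire g -> (0 <= \int[mu]_y (Q y * g y)%:E)%E.
  elim=> [f ? ? ?|g_ {}g bg IH cg]; first exact: tQ.
  have [|||||_ _ cv] := @dominated_convergence _ _ R mu _ (measurableT)
    (fun n y => (Q y * g_ n y)%:E) (fun y => (Q y * g y)%:E) (fun y => `|Q y|%:E).
  - by move=> n; have /measurable_int := iQg _ (bg n).
  - by apply: (@measurable_int _ _ _ mu); apply: iQg; exact: baire_lim cg.
  - apply/aeW => y _; apply: cvg_EFin; first by apply: nearW.
    by apply: cvgM; [exact: cvg_cst|exact: cg].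
  - exact: integrable_abse iQ.
  - apply/aeW => y n _; rewrite lee_fin normrM ler_piMr//.
    by have /andP[? ?] := baire_itv (bg n) y; rewrite ger0_norm.
  - rewrite -(cvg_lim _ cv)//; apply: lime_ge; first by apply/cvg_ex; eexists; exact: cv.
    by apply: nearW.
have mE : measurable [set y | Q y < 0].
  rewrite -[X in measurable X]setTI; exact: (measurable_fun_ltr mQ).
have bE := measurable_baire_set mE.
rewrite (_ : (fun y => (Num.max (Q y) 0)%:E) =
   (fun y => (Q y)%:E - (Q y * \1_[set y | Q y < 0] y)%:E)%E); last first.
  apply/funext => y; rewrite -EFinB indicE; congr _%:E.
  case: ltP => [Qy|Qy]; first by rewrite mem_set// mulr1 subrr.
  by rewrite memNset ?mulr0 ?subr0//= ltNge Qy.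
rewrite integralB//; last exact: iQg.
rewrite leeBlDr ?leeDl//; first exact: Qg0.
by apply: integrable_fin_num => //; exact: iQg.
Qed.

End baire_functions.

(** * Moments of the fundamental solution *)

Section moments.
Context {R : realType} {d : nat}.

Lemma bform_scalar (m : R) (v : 'cV[R]_d) : bform m%:M v v = m * dot v v.
Proof.
rewrite /bform mul_mx_scalar -scalemxAl mxE mxE; congr (_ * _).
by apply: eq_bigr => i _; rewrite mxE.
Qed.

Lemma loewner_scalar_le (a : 'M[R]_d) (m : R) :
  loewner_le a m%:M -> forall v, bform a v v <= m * dot v v.
Proof.
move=> am v; have := am v.
by rewrite mulmxBr mulmxBl [X in 0 <= X]mxE [X in _ + X]mxE
  -/(bform _ v v) bform_scalar subr_ge0.
Qed.

Lemma loewner_scalar_ge (a : 'M[R]_d) (m : R) :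
  loewner_le m%:M a -> forall v, m * dot v v <= bform a v v.
Proof.
move=> ma v; have := ma v.
by rewrite mulmxBr mulmxBl [X in 0 <= X]mxE [X in _ + X]mxE
  -!/(bform _ v v) bform_scalar subr_ge0.
Qed.

Lemma mxtrace_le_bound (a : 'M[R]_d) (m : R) :
  (forall v, bform a v v <= m * dot v v) -> \tr a <= d%:R * m.
Proof.
move=> am; rewrite mulr_natl -[X in _ *+ X]card_ord -sumr_const.
apply: ler_sum => i _; rewrite -bform_delta; apply: le_trans (am _) _.
rewrite /dot (bigD1 i)//= big1 ?addr0 ?mxE ?eqxx ?mulr1//.
by move=> j ji; rewrite mxE (negbTE ji) mul0r.
Qed.

(** The datum [c + |y|^2] gives the bound for the integral without the positive
    part; the data [- (c + |y|^2) f] with [0 <= f <= 1] show that the positive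
    part makes no difference. *)
Lemma green_moment_le (a : 'cV[R]_d -> 'M[R]_d) (b : 'cV[R]_d -> 'cV[R]_d)
    (p : R -> 'cV[R]_d -> 'cV[R]_d -> R) (La B2 t : R) :
  (forall x, (a x)^T = a x) -> (forall x v, 0 <= bform (a x) v v) ->
  (forall x, \tr (a x) <= La) ->
  (forall x v, bform (a x) v v <= La * dot v v) ->
  (forall x, dot (b x) (b x) <= B2) ->
  is_green a b p -> 0 < La + B2 -> 0 <= La -> 1 <= t ->
  measurable_fun setT (p t 0) /\
  (\int[lebesgue_vec d]_y
     (Num.max (p t 0 y * (t ^+ 2 * (La + B2) + dot y y)) 0)%:E <=
   (expR 1 * (t ^+ 2 * (La + B2)))%:E)%E.
Proof.
move=> a_sym a_psd a_trace a_bound b_bound hp C10 La0 t1.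
have t0 : 0 < t by lra.
set c := t ^+ 2 * (La + B2).
have c0 : 0 < c by rewrite mulr_gt0// exprn_gt0.
have cmp := cauchy_solution_le a_sym a_psd a_trace a_bound b_bound.
have cdot : continuous (fun y : 'cV[R]_d => c + dot y y).
  by move=> y; exact: (cvgD (cvg_cst _) (@continuous_dot R d y)).
have dot0 : dot (0 : 'cV[R]_d) 0 = 0 by rewrite /dot big1// => i _; rewrite mxE mul0r.
have cpos (y : 'cV[R]_d) : 0 <= c + dot y y by rewrite addr_ge0 ?dot_ge0 ?(ltW c0).
have grow (f : 'cV[R]_d -> R) : (forall y, `|f y| <= c + dot y y) ->
    exists K : R, forall y, `|f y| <= K * (1 + fnorm y ^+ 2).
  move=> fle; exists (c + 1) => y; apply: le_trans (fle y) _.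
  by rewrite sqr_fnorm; have := dot_ge0 y; nra.
have kc : La + B2 / t^-1 <= t^-1 * c.
  rewrite invrK /c expr2 mulrA mulKf ?gt_eqF// mulrDr [t * B2]mulrC lerD2r.
  by rewrite ler_peMl.
have growc (y : 'cV[R]_d) : `|c + dot y y| <= c + dot y y by rewrite ger0_norm.
have [u usol uP] := hp _ cdot (grow _ growc).
have [iq ut] := uP t 0 t0.
have ule : u 0 t <= expR 1 * c.
  have := cmp _ _ 1 c t^-1 usol ler01 (ltW c0) _ kc _ 0 t t0.
  rewrite dot0 addr0 mulVf ?gt_eqF// mul1r; apply; first by rewrite invr_gt0.
  by move=> x; rewrite mul1r.
have mq : measurable_fun setT (p t 0).
  have [||_ _ /(_ t 0 t0) [i1 _]] := hp (fun=> 1).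
  - exact: cst_continuous.
  - by exists 1 => y; rewrite normr1 mul1r lerDl sqr_ge0.
  apply/measurable_EFinP; have /measurable_int := i1.
  by under eq_fun do rewrite mulr1.
split=> //; apply: le_trans (integral_pos_part_le iq _) _; last first.
  rewrite -[leLHS]fineK; last exact: integrable_fin_num.
  by rewrite lee_fin -/(Rintegral _ _ _) -ut.
move=> f cf mf f01.
have [||v vsol /(_ t 0 t0) [iv vt]] := hp (fun y => - ((c + dot y y) * f y)).
- by move=> y; exact: (cvgN (cvgM (cdot y) (cf y))).
- apply: grow => y; rewrite normrN normrM ger0_norm// ler_piMr//.
  by have /andP[? ?] := f01 y; rewrite ger0_norm.
have v0 : v 0 t <= 0.
  have := cmp _ _ 0 c t^-1 vsol (lexx 0) (ltW c0) _ kc _ 0 t t0.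
  rewrite !mul0r; apply; first by rewrite invr_gt0.
  move=> x; rewrite mul0r oppr_le0 mulr_ge0//.
  by have /andP[] := f01 x.
rewrite vt in v0.
have iv0 : (\int[lebesgue_vec d]_y (p t 0 y * - ((c + dot y y) * f y))%:E <= 0)%E.
  by rewrite -[leLHS]fineK; [rewrite lee_fin|exact: integrable_fin_num].
rewrite (_ : (fun y => _) =
    (fun y => (-1)%:E * (p t 0 y * - ((c + dot y y) * f y))%:E)%E).
  by rewrite integralZl// EFinN mulN1e oppe_ge0.
by apply/funext => y; rewrite -EFinM; congr _%:E; ring.
Qed.

End moments.

(** * Entropy relative to a Gaussian *)

Section gaussian.
Context {R : realType}.

Definition gaussian n (s : R) (y : 'cV[R]_n) : R := \prod_i normal_pdf 0 s (y i 0).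

Lemma gaussian_ge0 n s (y : 'cV[R]_n) : 0 <= gaussian s y.
Proof. by apply: prodr_ge0 => i _; exact: normal_pdf_ge0. Qed.

Lemma measurable_gaussian n s : measurable_fun setT (@gaussian n s).
Proof.
apply: measurable_prod => i _.
exact: (measurableT_comp (measurable_normal_pdf 0 s) (@measurable_entry _ R n 1 i 0)).
Qed.

Lemma integral_gaussian n (s : R) :
  (\int[lebesgue_vec n]_y (gaussian s y)%:E = 1)%E.
Proof.
elim: n => [|n IH].
  rewrite /= integral_dirac//; last by apply/measurable_EFinP; exact: measurable_gaussian.
  by rewrite diracT mul1e /gaussian big_ord0.
transitivity (\int[pushforward (@lebesgue_measure R \x lebesgue_vec n) (@vcons R n)]_y
  (gaussian s y)%:E)%E; first by [].
rewrite ge0_integral_pushforward//=; last 3 first.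
- exact: measurable_vcons.
- by apply/measurable_EFinP; exact: measurable_gaussian.
- by move=> y _; rewrite lee_fin gaussian_ge0.
rewrite preimage_setT fubini_tonelli1//=; last 2 first.
- by apply/measurable_EFinP; exact: (measurableT_comp (measurable_gaussian s) (@measurable_vcons R n)).
- by move=> z; rewrite lee_fin gaussian_ge0.
rewrite -[RHS](integral_normal_pdf 0 s); apply: eq_integral => a _.
rewrite /fubini_F /=.
under eq_integral => v _.
  rewrite /gaussian big_ord_recl /vcons !mxE unlift_none /=.
  under eq_bigr => i _ do rewrite mxE liftK /=.
  rewrite -/(gaussian s v) EFinM; over.
rewrite ge0_integralZl//; last 3 first.
- by apply/measurable_EFinP; exact: measurable_gaussian.
- by move=> v _; rewrite lee_fin gaussian_ge0.
- by rewrite lee_fin normal_pdf_ge0.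
by rewrite IH mule1.
Qed.

(** For [x > 0] this is [ln (g / x) <= g / x - 1].  The positive part takes care of
    [x <= 0], where [ln x] is [0]. *)
Lemma gibbs_pointwise (x g : R) : 0 < g ->
  - (x * ln x) <= g + Num.max x 0 * - ln g.
Proof.
move=> g0; case: (leP x 0) => x0.
  by rewrite ln0// mulr0 oppr0 mul0r addr0 ltW.
have := @le_ln1Dx R (g / x - 1); rewrite addrCA subrr addr0 ltrBrDl addrN.
rewrite divr_gt0// => /(_ isT); rewrite ln_div ?posrE// => H.
have : x * (ln g - ln x) <= x * (g / x - 1) by rewrite ler_wpM2l// ltW.
rewrite (_ : x * (g / x - 1) = g - x); last by field; rewrite gt_eqF.
lra.
Qed.

Lemma gaussian_gt0 n s (y : 'cV[R]_n) : s != 0 -> 0 < gaussian s y.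
Proof.
move=> s0; apply: prodr_gt0 => i _.
by rewrite normal_pdfE// mulr_gt0 ?expR_gt0// normal_peak_gt0.
Qed.

(** The square root in the normalisation is bounded by its argument, which is at
    least [1]; only the order [ln t] matters. *)
Lemma ln_gaussian n (t : R) (y : 'cV[R]_n) : 1 <= t ->
  - ln (gaussian t y) <= dot y y / (2 * t ^+ 2) + n%:R * (ln (2 * pi) + 2 * ln t).
Proof.
move=> t1; have t0 : 0 < t by lra.
have tn0 : t != 0 by rewrite gt_eqF.
have pi1 : 1 <= 2 * pi :> R by have := @pi_ge2 R; lra.
have one (x : R) : - ln (normal_pdf 0 t x) <= x * x / (2 * t ^+ 2) + (ln (2 * pi) + 2 * ln t).
  rewrite normal_pdfE// -[X in - ln X <= _]/(normal_peak t * normal_fun 0 t x).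
  rewrite [ln (normal_peak t * _)]lnM ?posrE ?expR_gt0 ?normal_peak_gt0//.
  rewrite /normal_fun expRK subr0 opprD addrC lerD//.
    by rewrite mulNr opprK expr2 mulr_natl.
  rewrite /normal_peak lnV ?posrE ?sqrtr_gt0 ?opprK; last first.
    by rewrite mulrn_wgt0// mulr_gt0 ?pi_gt0// exprn_gt0.
  have z1 : 1 <= 2 * pi * t ^+ 2.
    by rewrite mulr_ege1// exprn_ege1.
  have -> : ln (2 * pi) + 2 * ln t = ln (2 * pi * t ^+ 2).
    by rewrite [RHS]lnM ?posrE ?exprn_gt0 ?(lt_le_trans ltr01)// lnXn// [2 * ln t]mulr_natl.
  rewrite (_ : _ *+ 2 = 2 * pi * t ^+ 2); last by rewrite mulr2n; ring.
  rewrite ler_ln ?posrE ?sqrtr_gt0 ?(lt_le_trans ltr01)//.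
  rewrite -[leRHS]sqr_sqrtr ?(le_trans ler01)// expr2 ler_peMr ?sqrtr_ge0//.
  by rewrite -[leLHS]sqrtr1 ler_wsqrtr.
rewrite /gaussian /dot.
elim: n y => [y|n IH y]; first by rewrite !big_ord0 ln1 oppr0 mul0r mul0r addr0.
rewrite !big_ord_recl [ln (normal_pdf _ _ _ * _)]lnM ?posrE; last 2 first.
- by rewrite normal_pdfE// mulr_gt0 ?expR_gt0// normal_peak_gt0.
- by apply: prodr_gt0 => i _; rewrite normal_pdfE// mulr_gt0 ?expR_gt0// normal_peak_gt0.
have := IH (\col_i y (lift ord0 i) 0).
under eq_bigr do rewrite mxE; under [X in _ <= X / _ + _]eq_bigr do rewrite mxE.
have := one (y ord0 0); rewrite opprD mulrDl -[in n.+1%:R]addn1 natrD.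
lra.
Qed.

End gaussian.

Section entropy_bound.
Context {R : realType} {d : nat}.

(** The cross entropy with the Gaussian of standard deviation [t].  Its quadratic
    and its constant part are both bounded by multiples of [c + |y|^2], so that a
    single integral controls them. *)
Lemma entropy_le (q : 'cV[R]_d -> R) (t c M : R) : 1 <= t -> 0 < c ->
  measurable_fun setT q ->
  (\int[lebesgue_vec d]_y (Num.max (q y * (c + dot y y)) 0)%:E <= M%:E)%E ->
  let B := 1 + ((2 * t ^+ 2)^-1 + d%:R * (ln (2 * pi) + 2 * ln t) / c) * M in
  entropy_well_defined q /\ (entropy q <= B%:E)%E.
Proof.
move=> t1 c0 mq qM B.
have t0 : 0 < t by lra.
set W := (2 * t ^+ 2)^-1 + d%:R * (ln (2 * pi) + 2 * ln t) / c in B *.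
have l0 : 0 <= ln (2 * pi : R) + 2 * ln t.
  by rewrite addr_ge0 ?mulr_ge0 ?ln_ge0//; have := @pi_ge2 R; lra.
have W0 : 0 <= W.
  by rewrite addr_ge0 ?invr_ge0 ?mulr_ge0 ?sqr_ge0 ?invr_ge0// ltW.
pose F (y : 'cV[R]_d) :=
  ((gaussian t y)%:E + W%:E * (Num.max (q y * (c + dot y y)) 0)%:E)%E.
have mdot : measurable_fun setT (fun y : 'cV[R]_d => dot y y).
  by apply: measurable_sum => i; apply: measurable_funM; exact: measurable_entry.
have mmax : measurable_fun setT (fun y => (Num.max (q y * (c + dot y y)) 0)%:E).
  apply/measurable_EFinP; apply: measurable_maxr => //.
  by apply: measurable_funM => //; exact: measurable_funD.
have mg : measurable_fun setT (fun y : 'cV[R]_d => (gaussian t y)%:E).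
  by apply/measurable_EFinP; exact: measurable_gaussian.
have max0 y : (0 <= (Num.max (q y * (c + dot y y)) 0)%:E)%E by rewrite lee_fin le_max lexx orbT.
have mF : measurable_fun setT F.
  by apply: emeasurable_funD => //; apply: emeasurable_funM.
have F0 y : (0 <= F y)%E.
  by apply: adde_ge0; [rewrite lee_fin gaussian_ge0|rewrite mule_ge0// lee_fin].
have intF : (\int[lebesgue_vec d]_y F y <= B%:E)%E.
  rewrite /F ge0_integralD//; last 3 first.
  - by move=> y _; rewrite lee_fin gaussian_ge0.
  - by move=> y _; rewrite mule_ge0.
  - by apply: emeasurable_funM.
  have W0e : (0 <= W%:E)%E by rewrite lee_fin.
  rewrite ge0_integralZl//.
  by rewrite integral_gaussian /B [leRHS]EFinD [(W * M)%:E]EFinM leeD2l// lee_wpmul2l// lee_fin.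
have md : measurable_fun setT (entropy_density q).
  apply/measurable_EFinP; apply: measurable_funN; apply: measurable_funM => //.
  exact: measurableT_comp.
have dF y : (entropy_density q y <= F y)%E.
  rewrite /F /entropy_density -EFinM -EFinD lee_fin.
  have g0 := @gaussian_gt0 R d t y (lt0r_neq0 t0).
  apply: le_trans (gibbs_pointwise (q y) g0) _; rewrite lerD2l.
  have cy : 0 < c + dot y y by rewrite ltr_pwDl// dot_ge0.
  have -> : Num.max (q y * (c + dot y y)) 0 = Num.max (q y) 0 * (c + dot y y).
    by rewrite maxr_pMl ?mul0r ?(ltW cy).
  rewrite mulrCA ler_wpM2l ?le_max ?lexx ?orbT//.
  apply: le_trans (ln_gaussian y t1) _; rewrite [leRHS]mulrDl.
  have := dot_ge0 y => y0.
  have i0 : 0 <= (2 * t ^+ 2)^-1 by rewrite invr_ge0 mulr_ge0// sqr_ge0.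
  rewrite lerD//; first by rewrite mulrC ler_wpM2l//; lra.
  rewrite -[leRHS]mulrA ler_peMr ?mulr_ge0// mulrC mulrDl mulfV ?gt_eqF// lerDl.
  by rewrite divr_ge0// ltW.
have dpF : (\int[lebesgue_vec d]_y (entropy_density q)^\+ y <= B%:E)%E.
  apply: le_trans intF; apply: ge0_le_integral => //.
  - exact: measurable_funepos.
  - by move=> y _; rewrite funeposE ge_max dF F0.
split; first by apply: le_lt_trans dpF _; rewrite ltry.
rewrite /entropy integralE; apply: le_trans dpF.
by rewrite -[leRHS]adde0 leeD2l// oppe_le0 integral_ge0.
Qed.

End entropy_bound.

Theorem proposition4p2 (R : realType) (d : nat) (hd : (3 <= d)%N)
    (disp : measure_display) (Omega : measurableType disp)
    (P : probability Omega R)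
    (tau : 'cV[R]_d -> Omega -> Omega)
    (A : 'cV[R]_d -> Omega -> 'M[R]_d)
    (b : 'cV[R]_d -> Omega -> 'cV[R]_d)
    (eta0 : R) (henv : random_environment P tau A b eta0)
    (p : Omega -> R -> 'cV[R]_d -> 'cV[R]_d -> R)
    (hp : forall w, is_green (A ^~ w) (b ^~ w) (p w)) :
  exists2 C : R, 0 < C &
    forall (w : Omega) (t : R), 1 <= t ->
      entropy_well_defined (p w t 0) /\
      (entropy (p w t 0%R) <= (C * (ln t + 1))%:E)%E.
Proof.
have [nu nu1 ell] := env_elliptic henv.
have [C C0 bl] := env_bounded_lipschitz henv.
pose La := d%:R * nu; pose C1 := La + C ^+ 2.
have La0 : 0 < La by rewrite mulr_gt0// ?ltr0n; [exact: leq_trans hd|lra].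
have C10 : 0 < C1 by rewrite ltr_wpDr ?sqr_ge0.
have ub w y : forall v, bform (A y w) v v <= nu * dot v v.
  by have [_] := ell y w; exact: loewner_scalar_le.
have psd w y v : 0 <= bform (A y w) v v.
  have [/loewner_scalar_ge/(_ v) + _] := ell y w.
  by apply: le_trans; rewrite mulr_ge0 ?dot_ge0// invr_ge0; lra.
have trA w y : \tr (A y w) <= La by exact: mxtrace_le_bound (ub w y).
have ubLa w y v : bform (A y w) v v <= La * dot v v.
  apply: le_trans (ub w y v) _; rewrite ler_wpM2r ?dot_ge0// ler_peMl//; first by lra.
  by rewrite ler1n; exact: leq_trans hd.
have bB w y : dot (b y w) (b y w) <= C ^+ 2.
  have [+ _ _ _] := bl 0 y w; rewrite fnorm_dot => H.
  rewrite -[leLHS]sqr_sqrtr ?dot_ge0//.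
  by rewrite ler_pXn2r ?nnegrE ?sqrtr_ge0// ltW.
pose L := ln (2 * pi : R).
have L0 : 0 <= L by rewrite ln_ge0//; have := @pi_ge2 R; lra.
pose K := 1 + expR 1 * (C1 + d%:R * (L + 2)).
have K0 : 0 < K.
  by rewrite ltr_pwDl// mulr_ge0 ?expR_ge0// addr_ge0 ?(ltW C10)// mulr_ge0// addr_ge0.
exists K => // w t t1.
have t0 : 0 < t by lra.
have c0 : 0 < t ^+ 2 * C1 by rewrite mulr_gt0// exprn_gt0.
have [mq qM] := green_moment_le (fun x => env_sym henv x w) (psd w) (trA w)
  (ubLa w) (bB w) (hp w) C10 (ltW La0) t1.
have [wd Hle] := entropy_le t1 c0 mq qM; split => //.
apply: le_trans Hle _; rewrite lee_fin.
have lt0 : 0 <= ln t by rewrite ln_ge0.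
have -> : 1 + ((2 * t ^+ 2)^-1 +
      d%:R * (ln (2 * pi) + 2 * ln t) / (t ^+ 2 * C1)) * (expR 1 * (t ^+ 2 * C1)) =
    1 + expR 1 * (C1 / 2 + d%:R * (L + 2 * ln t)).
  by rewrite /L; field; rewrite gt_eqF// gt_eqF.
have e0 := expR_ge0 (1 : R); have d0 : 0 <= d%:R :> R by [].
have dL : 0 <= d%:R * L by rewrite mulr_ge0.
have dl : 0 <= d%:R * ln t by rewrite mulr_ge0.
have : expR 1 * (C1 / 2 + d%:R * (L + 2 * ln t)) <=
    expR 1 * (C1 + d%:R * (L + 2)) * (ln t + 1).
  rewrite -mulrA ler_wpM2l//; nra.
rewrite /K; lra.
Qed.
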